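(* The following assertions hold. (i) Let $\mathcal{B}$ be a covering of a separable infinite-dimensional real Hilbert space by closed or open balls (each member of $\mathcal{B}$ is either an open ball of positive radius or a closed ball of non-negative radius, so singletons are allowed). If $\mathcal{B}$ is point-finite, then $|\mathcal{B}|=2^{\aleph_0}$. (ii) If $\Gamma$ is an infinite set such that $|\Gamma|<2^{\aleph_0}$, then the real Hilbert space $\ell_2(\Gamma)$ does not admit a point-finite covering by open or closed balls, each of positive radius. (iii) Let $\mathcal{B}$ be a covering of an infinite-dimensional real Hilbert space by open balls (of positive radius). Then $\mathcal{B}$ is not point-finite.
   Context: All spaces are real. A family of subsets of a normed space $X$ is a covering of $X$ if the union of its members is $X$. It is point-finite if each $x\in X$ belongs to at most finitely many members of the family. ''A family of open or closed balls'' means that each member is either an open ball or a closed ball; both kinds may occur in the same family. Open balls $U(x,\varepsilon)$ have radius $\varepsilon>0$; closed balls $B(x,\varepsilon)$ have radius $\varepsilon\ge 0$, where for $\varepsilon=0$ the closed ball is the degenerate ball $\{x\}$. *)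

(* Defs.v *)
From HB Require Import structures.
From mathcomp Require Import all_boot all_order all_algebra.
From mathcomp Require Import all_classical all_reals all_analysis.
From mathcomp Require Import ring lra.
From mathcomp Require Import finmap sesquilinear.

Set Implicit Arguments.
Unset Strict Implicit.
Unset Printing Implicit Defensive.

Import Order.TTheory GRing.Theory Num.Theory.
Import numFieldNormedType.Exports.

Local Open Scope classical_set_scope.
Local Open Scope ring_scope.
Local Open Scope card_scope.

Definition covering (T : Type) (B : set (set T)) : Prop :=
  \bigcup_(A in B) A = [set: T].

Definition point_finite (T : Type) (B : set (set T)) : Prop :=
  forall x, finite_set [set A | B A /\ A x].

(* The closed ball is [closed_ball_], defined by the inequality
   `|c - y| <= r; the library's [closed_ball], the closure of the open ball,
   is empty for r = 0. *)
Section balls.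
Context (R : realType) (E : normedModType R).

Definition open_balls : set (set E) :=
  [set A | exists c : E, exists2 r : R, 0 < r & A = ball c r].

Definition closed_balls : set (set E) :=
  [set A | exists c : E, exists2 r : R, 0 <= r &
    A = closed_ball_ Num.norm c r].

Definition nondegenerate_closed_balls : set (set E) :=
  [set A | exists c : E, exists2 r : R, 0 < r &
    A = closed_ball_ Num.norm c r].

End balls.
Arguments open_balls {R} E.
Arguments closed_balls {R} E.
Arguments nondegenerate_closed_balls {R} E.

Definition hilbert_space (R : realType) (H : completeNormedModType R) : Prop :=
  exists dot : {dot H for (@idfun R)}, forall x, `|x| = Num.sqrt (dot x x).

Definition infinite_dimensional (R : realType) (E : lmodType R) : Prop :=
  ~ exists (n : nat) (e : 'I_n -> E),
      forall x, exists a : 'I_n -> R, x = \sum_(i < n) a i *: e i.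

Definition separable (T : topologicalType) : Prop :=
  exists2 D : set T, countable D & dense D.

Definition card_lt (T U : Type) (A : set T) (B : set U) : Prop :=
  A #<= B /\ ~ (B #<= A).

Section l2.
Context (R : realType) (I : choiceType).
Implicit Types f g h : I -> R.

Definition sumsq f : \bar R := (\esum_(i in [set: I]) (f i ^+ 2)%:E)%E.

Definition l2_pred : {pred I -> R} := [pred f | (sumsq f < +oo)%E].

Record l2 := L2 { l2_fun :> I -> R; l2_funP : l2_fun \in l2_pred }.

HB.instance Definition _ := [isSub for l2_fun].
HB.instance Definition _ := [Choice of l2 by <:].

Lemma sumsq_ge0 f : (0 <= sumsq f)%E.
Proof. by apply: esum_ge0 => i _; rewrite lee_fin sqr_ge0. Qed.

Lemma sumsqZ_le (c : R) f : (sumsq (c *: f) <= (c ^+ 2)%:E * sumsq f)%E.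
Proof.
apply: ge_ereal_sup => _ [X [finX XI]] <-.
rewrite (eq_fsbigr (fun i => (c ^+ 2)%:E * (f i ^+ 2)%:E)%E); last first.
  by move=> i _; rewrite -EFinM -exprMn.
rewrite -ge0_mule_fsumr; last by move=> i; rewrite lee_fin sqr_ge0.
by apply: lee_wpmul2l; [rewrite lee_fin sqr_ge0 | apply: esum_ge; exists X].
Qed.

Lemma sumsq_add f g :
  (sumsq f + sumsq g = \esum_(i in [set: I]) (f i ^+ 2 + g i ^+ 2)%:E)%E.
Proof. by rewrite -esumD// => i _; rewrite lee_fin sqr_ge0. Qed.

Lemma sumsqD_le f g :
  (sumsq (f + g)%R <= sumsq f + sumsq f + (sumsq g + sumsq g))%E.
Proof.
rewrite !sumsq_add -esumD; last 2 first.
- by move=> i _; rewrite lee_fin addr_ge0 ?sqr_ge0.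
- by move=> i _; rewrite lee_fin addr_ge0 ?sqr_ge0.
apply: le_esum => i _; rewrite -EFinD lee_fin.
change ((f i + g i) ^+ 2 <= f i ^+ 2 + f i ^+ 2 + (g i ^+ 2 + g i ^+ 2)).
rewrite -subr_ge0 [X in 0 <= X](_ : _ = (f i - g i) ^+ 2) ?sqr_ge0//; ring.
Qed.

Lemma l2_submod_closed : submod_closed l2_pred.
Proof.
split=> [|c f g]; rewrite !inE.
  by rewrite /sumsq esum1 ?ltry// => i _; rewrite expr0n.
move=> fI gI; apply: (le_lt_trans (sumsqD_le _ _)).
have gfin : sumsq g \is a fin_num by rewrite ge0_fin_numE ?sumsq_ge0.
have ffin : sumsq f \is a fin_num by rewrite ge0_fin_numE ?sumsq_ge0.
have : (sumsq (c *: f) < +oo)%E.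
  apply: (le_lt_trans (sumsqZ_le _ _)).
  by rewrite -(fineK ffin) -EFinM ltry.
move=> cfI.
have cffin : sumsq (c *: f) \is a fin_num by rewrite ge0_fin_numE ?sumsq_ge0.
by rewrite -(fineK cffin) -(fineK gfin) -!EFinD ltry.
Qed.

HB.instance Definition _ :=
  GRing.isSubmodClosed.Build R (I -> R) l2_pred l2_submod_closed.
HB.instance Definition _ := [SubChoice_isSubLmodule of l2 by <:].

Implicit Types u v w : l2.

Lemma l2_ext u v : (forall i, u i = v i) -> u = v.
Proof. by move=> uv; apply: val_inj; apply/funext. Qed.

Lemma l2D u v i : (u + v) i = u i + v i. Proof. by []. Qed.
Lemma l2N u i : (- u) i = - u i. Proof. by []. Qed.
Lemma l2Z c u i : (c *: u) i = c * u i. Proof. by []. Qed.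

Definition l2_norm u : R := Num.sqrt (fine (sumsq u)).

Lemma l2_norm_ge0 u : 0 <= l2_norm u. Proof. exact: sqrtr_ge0. Qed.

Lemma l2_normE u : ((l2_norm u) ^+ 2)%:E = sumsq u.
Proof.
rewrite sqr_sqrtr ?fine_ge0 ?sumsq_ge0// fineK// ge0_fin_numE ?sumsq_ge0//.
by have := l2_funP u; rewrite inE.
Qed.

Lemma l2_norm_le u c : 0 <= c -> (sumsq u <= (c ^+ 2)%:E)%E -> l2_norm u <= c.
Proof. by move=> c0; rewrite -l2_normE lee_fin ler_pXn2r// nnegrE l2_norm_ge0. Qed.

Lemma l2_coord_le u i : `|u i| <= l2_norm u.
Proof.
rewrite -(@ler_pXn2r _ 2)// ?nnegrE ?l2_norm_ge0// real_normK ?num_real//.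
rewrite -lee_fin l2_normE; apply: esum_ge; exists [set i].
  by split => //; exact: finite_set1.
by rewrite fsbig_set1.
Qed.

Lemma l2_norm_eq0 u : l2_norm u = 0 -> u = 0.
Proof.
move=> u0; apply: l2_ext => i; apply/eqP; rewrite -normr_le0.
by rewrite (le_trans (l2_coord_le _ _)) ?u0.
Qed.

Lemma l2_normZ_le c u : l2_norm (c *: u) <= `|c| * l2_norm u.
Proof.
apply: l2_norm_le; first by rewrite mulr_ge0 ?l2_norm_ge0.
by rewrite exprMn real_normK ?num_real// EFinM l2_normE sumsqZ_le.
Qed.

Lemma l2_normZ c u : l2_norm (c *: u) = `|c| * l2_norm u.
Proof.
apply/eqP; rewrite eq_le l2_normZ_le/=.
have [->|c0] := eqVneq c 0; first by rewrite normr0 mul0r l2_norm_ge0.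
rewrite -ler_pdivlMl ?normr_gt0// -normfV.
by have := l2_normZ_le c^-1 (c *: u); rewrite scalerA mulVf// scale1r.
Qed.

Lemma l2_normD u v : l2_norm (u + v) <= l2_norm u + l2_norm v.
Proof.
set a := l2_norm u; set b := l2_norm v.
have [a0|a0] := eqVneq a 0; first by rewrite (l2_norm_eq0 a0) a0 !add0r.
have [b0|b0] := eqVneq b 0; first by rewrite (l2_norm_eq0 b0) b0 !addr0.
have {}a0 : 0 < a by rewrite lt_neqAle eq_sym a0 l2_norm_ge0.
have {}b0 : 0 < b by rewrite lt_neqAle eq_sym b0 l2_norm_ge0.
apply: l2_norm_le; first by rewrite ltW// addr_gt0.
pose p := Num.sqrt ((a + b) / a); pose q := Num.sqrt ((a + b) / b).
have p2 : p ^+ 2 = (a + b) / a by rewrite sqr_sqrtr// ltW// divr_gt0// addr_gt0.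
have q2 : q ^+ 2 = (a + b) / b by rewrite sqr_sqrtr// ltW// divr_gt0// addr_gt0.
apply: (@le_trans _ _ (sumsq (p *: u) + sumsq (q *: v))%E).
  rewrite sumsq_add; apply: le_esum => i _; rewrite lee_fin l2D !l2Z !exprMn p2 q2.
  have -> : (a + b) / a * u i ^+ 2 + (a + b) / b * v i ^+ 2 =
      (u i + v i) ^+ 2 + (b * u i - a * v i) ^+ 2 / (a * b).
    by field; rewrite !gt_eqF.
  by rewrite lerDl divr_ge0 ?sqr_ge0// ltW// mulr_gt0.
rewrite -!l2_normE !l2_normZ !exprMn !real_normK ?num_real// p2 q2 -/a -/b.
rewrite -EFinD lee_fin le_eqVlt; apply/orP; left; apply/eqP.
by field; rewrite !gt_eqF.
Qed.

HB.instance Definition _ :=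
  @Lmodule_isNormed.Build R l2 l2_norm l2_normD l2_normZ l2_norm_eq0.

Lemma l2_normrE u : `|u| = l2_norm u. Proof. by []. Qed.

Lemma l2_complete (F : set_system l2) : ProperFilter F -> cauchy F -> cvg F.
Proof.
move=> FF /cauchy_ballP Fc.
have Fclose e : 0 < e -> exists2 A, F A & forall u v, A u -> A v -> `|u - v| <= e.
  move=> e0; have [[A B]/= [FA FB] AB] := Fc _ e0.
  exists (A `&` B) => [|u v [Au Bu] [Av Bv]]; first exact: filterI.
  by have := AB (u, v) (conj Au Bv); rewrite -ball_normE/= => /ltW.
have cvgF i : cvg ((fun u : l2 => u i) @ F).
  apply: cauchy_cvg; apply/cauchy_ballP => e e0.
  have e20 : 0 < e / 2 by rewrite divr_gt0.
  have [A FA Ae] := Fclose _ e20.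
  pose Ai := (fun u : l2 => u i) @` A.
  have FAi : F ((fun u : l2 => u i) @^-1` Ai).
    by apply: filterS FA => w Aw; exists w.
  exists (Ai, Ai) => //.
  move=> [_ _]/= [[u Au <-] [v Av <-]]; rewrite /ball/=.
  rewrite (le_lt_trans (l2_coord_le (u - v) i))//.
  by rewrite (le_lt_trans (Ae _ _ Au Av))// ltr_pdivrMr// ltr_pMr// ltr1n.
pose h i : R := lim ((fun u : l2 => u i) @ F).
have hE i : (fun u : l2 => u i) @ F --> h i by exact: cvgF.
have near_h e A : 0 < e -> F A -> (forall u v, A u -> A v -> `|u - v| <= e) ->
    forall u, A u -> (sumsq (\val u - h)%R <= (e ^+ 2)%:E)%E.
  move=> e0 FA Ae u Au; apply: ge_ereal_sup => _ [X [finX _]] <-.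
  rewrite fsumEFin// lee_fin fsbig_finite//=.
  have cvgX : (fun v : l2 => \sum_(k <- fset_set X) (u k - v k) ^+ 2) @ F -->
      \sum_(k <- fset_set X) (u k - h k) ^+ 2.
    apply: cvg_big => [|k _]; first exact: add_continuous.
    by apply: cvgM; apply: cvgB => //; exact: cvg_cst.
  apply: (cvgr_to_le cvgX).
  apply: filterS FA => v Av.
  rewrite -lee_fin; apply: (@le_trans _ _ (sumsq (u - v))).
    by apply: esum_ge; exists X => //; rewrite fsumEFin// fsbig_finite.
  rewrite -l2_normE lee_fin ler_pXn2r ?nnegrE ?l2_norm_ge0 ?(ltW e0)//.
  exact: Ae.
have [A1 FA1 A1e] := Fclose 1 ltr01.
have [u0 Au0] := filter_ex FA1.
have hP : h \in l2_pred.
  have d0 : (\val u0 - h)%R \in l2_pred.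
    by rewrite inE (le_lt_trans (near_h _ _ ltr01 FA1 A1e _ Au0))// ltry.
  by rewrite -[h](subKr (\val u0)) rpredB//; exact: l2_funP.
apply/cvg_ex; exists (L2 hP); apply/cvgrPdist_le => e e0.
have [A FA Ae] := Fclose e e0.
apply: filterS (FA) => u Au; rewrite distrC l2_normrE.
by apply: l2_norm_le; [exact: ltW | exact: (near_h _ _ e0 FA Ae)].
Qed.

HB.instance Definition _ := Uniform_isComplete.Build l2 l2_complete.

Let sq u : R := `|u| ^+ 2.

Let sqE u : (sq u)%:E = sumsq u. Proof. exact: l2_normE. Qed.

Let sqD3 u1 u2 u3 v1 v2 v3 :
  (forall i, u1 i ^+ 2 + u2 i ^+ 2 + u3 i ^+ 2 =
             v1 i ^+ 2 + v2 i ^+ 2 + v3 i ^+ 2) ->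
  sq u1 + sq u2 + sq u3 = sq v1 + sq v2 + sq v3.
Proof.
have sqE3 w1 w2 w3 : (sq w1 + sq w2 + sq w3)%:E =
    (\esum_(i in [set: I]) (w1 i ^+ 2 + w2 i ^+ 2 + w3 i ^+ 2)%:E)%E.
  rewrite !EFinD !sqE sumsq_add -esumD// => i _; rewrite lee_fin ?sqr_ge0//.
  by rewrite addr_ge0 ?sqr_ge0.
move=> uv; apply: EFin_inj; rewrite !sqE3.
by apply: eq_esum => i _; rewrite uv.
Qed.

Let sqZ c u : sq (c *: u) = c ^+ 2 * sq u.
Proof. by rewrite /sq normrZ exprMn real_normK ?num_real. Qed.

Let sq0 : sq 0 = 0. Proof. by rewrite /sq normr0 expr0n. Qed.

(* Polarization: avoids the signed sum of the u i * v i. *)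
Definition l2_dot u v : R := (`|u + v| ^+ 2 - `|u - v| ^+ 2) / 4.

Lemma l2_dotC u v : l2_dot u v = l2_dot v u.
Proof. by rewrite /l2_dot (addrC u v) distrC. Qed.

Lemma l2_dotDl u u' v : l2_dot (u + u') v = l2_dot u v + l2_dot u' v.
Proof.
have : sq (u + u' + v) + sq (u - v) + sq (u' - v) =
       sq (u + u' - v) + sq (u + v) + sq (u' + v).
  by apply: sqD3 => i; rewrite !l2D !l2N; ring.
by rewrite /l2_dot /sq => ?; lra.
Qed.

Lemma l2_dotZl c u v : l2_dot (c *: u) v = c * l2_dot u v.
Proof.
have dotZ_ge0 a w : 0 <= a -> l2_dot (a *: w) v = a * l2_dot w v.
  move=> a0; have aE : a = Num.sqrt a ^+ 2 by rewrite sqr_sqrtr.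
  have : sq (a *: w + v) + sq (Num.sqrt a *: (w - v)) + sq 0 =
         sq (a *: w - v) + sq (Num.sqrt a *: (w + v)) + sq 0.
    apply: sqD3 => i; rewrite !(l2Z, l2D, l2N) !exprMn -aE; ring.
  by rewrite !sqZ -aE /l2_dot /sq => ?; lra.
have dotN w : l2_dot (- w) v = - l2_dot w v.
  rewrite /l2_dot -opprD (normrN (w + v)) (addrC (- w) v) (distrC v w); lra.
have [c0|/ltW c0] := leP 0 c; first exact: dotZ_ge0.
have := @dotZ_ge0 (- c) (- u); rewrite oppr_ge0 => /(_ c0).
by rewrite scalerN scaleNr opprK dotN mulrNN.
Qed.

Let l2_dot_bilinear : bilinear_for *%R (@idfun R \; *%R) l2_dot.
Proof.
split=> [v c u u'|u c v v'] /=.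
  by rewrite l2_dotDl l2_dotZl.
by rewrite ![l2_dot u _]l2_dotC l2_dotDl l2_dotZl.
Qed.

HB.instance Definition _ := bilinear_isBilinear.Build R l2 l2 R
  (GRing.Scale.Law.clone _ _ ( *%R ) _)
  (GRing.Scale.Law.clone _ _ (@idfun R \; *%R ) _) l2_dot l2_dot_bilinear.

Let l2_dot_hermitian u v : l2_dot u v = (-1) ^+ false * @idfun R (l2_dot v u).
Proof. by rewrite expr0 mul1r l2_dotC. Qed.

HB.instance Definition _ :=
  isHermitianSesquilinear.Build R l2 false (@idfun R) l2_dot l2_dot_hermitian.

Lemma l2_dotxx u : l2_dot u u = `|u| ^+ 2.
Proof.
have -> : l2_dot u u = (sq (2 *: u) - sq 0) / 4.
  by rewrite /l2_dot subrr scaler_nat mulr2n.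
by rewrite sqZ sq0 /sq; field.
Qed.

Let l2_dot_gt0 u : u != 0 -> 0 < l2_dot u u.
Proof. by move=> u0; rewrite l2_dotxx exprn_gt0// normr_gt0. Qed.

HB.instance Definition _ := isDotProduct.Build R l2 l2_dot l2_dot_gt0.

Lemma l2_hilbert : hilbert_space l2.
Proof. by exists l2_dot => u; rewrite [X in Num.sqrt X]l2_dotxx sqrtr_sqr normr_id. Qed.

End l2.

(* Main.v *)
(* A countable point-finite family of balls (open, closed or degenerate) never
   covers an infinite-dimensional Hilbert space.  For any x0 and any large T, each
   ball cuts the sphere |x - x0|^2 = T in a slice {dot z c >= b}, z = x - x0, with
   b > 0 (point-finiteness at x0).  If |z|^2 < T and z lies in none of these
   half-spaces, then by Banach-Steinhaus z has a positive distance to their union: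
   every ray from z hits the sphere, where it meets finitely many slices only.  So
   one can walk from 0 to the sphere with orthogonal steps, step n being parallel
   to the first n hyperplanes; the limit lies in none of the half-spaces.

   Keeping the walk inside a hyperplane dot x e = t gives one uncovered point for
   each real t, hence the cardinality in (i).  For (ii) and (iii) the walk stays in
   a separable subspace.  In (iii) only countably many open balls meet it.  In
   (ii) the uncovered points lie in continuum many distinct closed balls tangent to
   the subspace; adding a suitable basis vector to the subspace makes it meet the
   interior of such a ball, each basis vector serves only countably many balls, and
   Koenig's theorem then gives a continuum of basis vectors. *)
Require Import Defs.
From HB Require Import structures.
From mathcomp Require Import all_boot all_order all_algebra.
From mathcomp Require Import all_classical all_reals all_analysis.
From mathcomp Require Import ring lra.
From mathcomp Require Import sesquilinear.

Set Implicit Arguments.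
Unset Strict Implicit.
Unset Printing Implicit Defensive.

Import Order.TTheory GRing.Theory Num.Theory.
Import numFieldNormedType.Exports.

Local Open Scope classical_set_scope.
Local Open Scope ring_scope.
Local Open Scope card_scope.

(** * Inner product calculus *)

Definition inner_product (R : realType) (H : normedModType R)
    (dot : H -> H -> R) : Prop :=
  [/\ forall x y, dot x y = dot y x,
      forall a x y z, dot (a *: x + y) z = a * dot x z + dot y z
    & forall x, dot x x = `|x| ^+ 2].

Lemma hilbert_inner_product (R : realType) (H : completeNormedModType R) :
  hilbert_space H -> exists dot : H -> H -> R, inner_product dot.
Proof.
move=> [dot normE]; exists dot; split=> [x y|a x y z|x].
- by rewrite hermC expr0 mul1r.
- by rewrite linearPl.
- rewrite normE sqr_sqrtr//.
  by have [->|x0] := eqVneq x 0; [rewrite linear0l | rewrite ltW ?neq0_dnorm_gt0].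
Qed.

Section inner_product.
Context (R : realType) (H : normedModType R) (dot : H -> H -> R).
Hypothesis dotP : inner_product dot.
Implicit Types (x y z u v : H) (a t : R).

Lemma dotC x y : dot x y = dot y x. Proof. by case: dotP. Qed.

Lemma dotxx x : dot x x = `|x| ^+ 2. Proof. by case: dotP. Qed.

Lemma dotDl x y z : dot (x + y) z = dot x z + dot y z.
Proof. by case: dotP => _ lin _; rewrite -[x]scale1r lin mul1r scale1r. Qed.

Lemma dot0l z : dot 0 z = 0.
Proof. by apply: (addrI (dot 0 z)); rewrite -dotDl !addr0. Qed.

Lemma dotZl a x z : dot (a *: x) z = a * dot x z.
Proof. by case: dotP => _ lin _; rewrite -[a *: x]addr0 lin dot0l addr0. Qed.

Lemma dotNl x z : dot (- x) z = - dot x z.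
Proof. by rewrite -scaleN1r dotZl mulN1r. Qed.

Lemma dotDr x y z : dot z (x + y) = dot z x + dot z y.
Proof. by rewrite dotC dotDl !(dotC z). Qed.

Lemma dot0r z : dot z 0 = 0. Proof. by rewrite dotC dot0l. Qed.

Lemma dotZr a x z : dot z (a *: x) = a * dot z x.
Proof. by rewrite dotC dotZl dotC. Qed.

Lemma dotNr x z : dot z (- x) = - dot z x.
Proof. by rewrite dotC dotNl dotC. Qed.

Definition dotE := (dotDl, dotDr, dotNl, dotNr, dotZl, dotZr).

Lemma sqr_normD x y : `|x + y| ^+ 2 = `|x| ^+ 2 + 2 * dot x y + `|y| ^+ 2.
Proof. by rewrite -!dotxx !dotE (dotC y); ring. Qed.

Lemma sqr_normB x y : `|x - y| ^+ 2 = `|x| ^+ 2 - 2 * dot x y + `|y| ^+ 2.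
Proof. by rewrite sqr_normD normrN dotNr; ring. Qed.

Lemma polarization x y : dot x y = (`|x + y| ^+ 2 - `|x - y| ^+ 2) / 4.
Proof. by rewrite sqr_normD sqr_normB; field. Qed.

Lemma Cauchy_Schwarz x y : `|dot x y| <= `|x| * `|y|.
Proof.
have [->|y0] := eqVneq y 0; first by rewrite dot0r !normr0 mulr0.
have y2 : 0 < `|y| ^+ 2 by rewrite exprn_gt0 ?normr_gt0.
rewrite -(@ler_pXn2r _ 2)// ?nnegrE ?mulr_ge0// real_normK ?num_real//.
(* Up to the factor [|y| ^+ 2], this vector is the component of [x] orthogonal to [y]. *)
have := sqr_ge0 `|(`|y| ^+ 2) *: x - dot x y *: y|.
rewrite sqr_normB !normrZ !exprMn dotZl dotZr !real_normK ?num_real//.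
rewrite (_ : _ + _ = `|y| ^+ 2 * ((`|x| * `|y|) ^+ 2 - dot x y ^+ 2)); last by ring.
by rewrite pmulr_rge0 // subr_ge0 exprMn.
Qed.

Lemma dot_le x y : dot x y <= `|x| * `|y|.
Proof. exact: le_trans (ler_norm _) (Cauchy_Schwarz _ _). Qed.

Lemma sqr_normM v a : `|a *: v| ^+ 2 = a ^+ 2 * `|v| ^+ 2.
Proof. by rewrite normrZ exprMn real_normK ?num_real. Qed.

Lemma dot_cst (y : nat -> H) x z k N :
  y @ \oo --> x -> (forall n, (N <= n)%N -> dot (y n) z = k) -> dot x z = k.
Proof.
move=> yx yk; apply/eqP; rewrite -subr_eq0 -normr_le0.
apply/ler_addgt0Pl => e e0; rewrite addr0.
have e1 : 0 < e / (`|z| + 1) by rewrite divr_gt0// ltr_wpDl.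
have /cvgrPdist_lt/(_ _ e1)[M _ yM] := yx.
have := yM (maxn M N) (leq_maxl _ _) => /= /ltW yxe.
rewrite -(yk (maxn M N)) ?leq_maxr// -dotNl -dotDl.
apply: le_trans (Cauchy_Schwarz _ _) _.
apply: (@le_trans _ _ (e / (`|z| + 1) * (`|z| + 1))).
  by rewrite ler_pM// lerDl.
by rewrite divfK// gt_eqF// ltr_wpDl.
Qed.

(** [s] is the positive root of a quadratic whose constant term [|x| ^+ 2 - t] is negative. *)
Lemma ray_meets_sphere x v t :
  v != 0 -> `|x| ^+ 2 < t -> exists2 s, 0 < s & `|x + s *: v| ^+ 2 = t.
Proof.
move=> v0 xt; pose a := `|v| ^+ 2; pose b := dot x v.
have a0 : 0 < a by rewrite exprn_gt0 ?normr_gt0.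
pose d := Num.sqrt (b ^+ 2 + a * (t - `|x| ^+ 2)).
have ad : 0 < a * (t - `|x| ^+ 2) by rewrite mulr_gt0 ?subr_gt0.
have d2 : d ^+ 2 = b ^+ 2 + a * (t - `|x| ^+ 2).
  by rewrite sqr_sqrtr// addr_ge0 ?sqr_ge0 ?ltW.
have bd : b < d.
  apply: le_lt_trans (ler_norm b) _.
  rewrite -(@ltr_pXn2r _ 2)// ?nnegrE ?sqrtr_ge0// real_normK ?num_real//.
  by rewrite d2 ltrDl.
exists ((d - b) / a); first by rewrite divr_gt0// subr_gt0.
rewrite sqr_normD sqr_normM dotZr -/a -/b.
have -> : ((d - b) / a) ^+ 2 * a = (d ^+ 2 - 2 * b * d + b ^+ 2) / a.
  by field; rewrite gt_eqF.
by rewrite d2; field; rewrite gt_eqF.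
Qed.

End inner_product.

(** * Uniform boundedness and near-maximal choices *)

Lemma finite_set_bound (R : realType) (T : Type) (A : set T) (f : T -> R) :
  finite_set A -> exists2 M, 0 < M & forall i, A i -> f i <= M.
Proof.
elim/Pchoice: T => T in A f *.
move=> /finite_seqP[s ->]; exists (1 + \sum_(i <- s) `|f i|).
  by rewrite ltr_wpDr// sumr_ge0.
move=> i /= /(big_rem i) ->; rewrite addrCA (le_trans (ler_norm _))// lerDl.
by rewrite addr_ge0// sumr_ge0.
Qed.

(** Uniform boundedness of the functionals [dot ^~ (c i)]; evaluating each at the normalized [c i]
    recovers its norm. *)
Lemma dot_banach_steinhaus (R : realType) (H : completeNormedModType R)
    (dot : H -> H -> R) (I : Type) (J : set I) (c : I -> H) :
  inner_product dot ->
  (forall v, exists M, forall i, J i -> `|dot v (c i)| <= M) ->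
  exists2 M, 0 < M & forall i, J i -> `|c i| <= M.
Proof.
move=> dotP bnd; pose F : set (H -> R^o) := (fun i v => dot v (c i)) @` J.
have Flin f : F f -> bounded_fun_norm f /\ linear f.
  move=> [i Ji <-]; split=> [r|a u v]; last by rewrite (dotDl dotP) (dotZl dotP).
  exists (r * `|c i|) => x xr; apply: le_trans (Cauchy_Schwarz dotP _ _) _.
  exact: ler_wpM2r.
have Fbnd : pointwise_bounded F.
  by move=> v; have [M vM] := bnd v; exists M => _ [i Ji <-]; exact: vM.
have [M FM] := Banach_Steinhauss Flin Fbnd 1.
exists (`|M| + 1) => [|i Ji]; first by rewrite ltr_wpDl.
have [->|ci0] := eqVneq (c i) 0; first by rewrite normr0 addr_ge0.
have := FM _ (ex_intro2 _ _ i Ji erefl) (`|c i|^-1 *: c i).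
rewrite normrZ normfV normr_id mulVf ?normr_eq0// => /(_ (lexx _)).
rewrite (dotZl dotP) (dotxx dotP) normrM normfV normr_id normrX normr_id.
rewrite expr2 mulKf ?normr_eq0// => /le_trans; apply.
by rewrite (le_trans (ler_norm _))// lerDl.
Qed.

(** The supremum need not be attained, but some element exceeds half of it; this is how the walk
    gets nearly longest steps. *)
Lemma near_maximal (R : realType) (G : set R) (M : R) :
  (exists2 e, 0 < e & G e) -> (forall e, G e -> e <= M) ->
  exists2 e, 0 < e & G e /\ forall e', G e' -> e' <= 2 * e.
Proof.
move=> [e0 e0_gt0 Ge0] GM.
have Gub : has_ubound G by exists M => e; exact: GM.
have s0 : 0 < sup G by apply: lt_le_trans e0_gt0 _; exact: ub_le_sup.
have [||e Ge] := @sup_adherent _ G (sup G / 2).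
- by rewrite divr_gt0.
- by split => //; exists e0.
rewrite {1}[sup G]splitr addrK => se; exists e; first by apply: lt_trans se; rewrite divr_gt0.
split=> // e' /(ub_le_sup Gub); lra.
Qed.

(** * Half-spaces and orthogonal walks *)

Section halfspaces.
Context (R : realType) (H : completeNormedModType R) (dot : H -> H -> R).
Hypothesis dotP : inner_product dot.

(** At the point [s *: v] all but finitely many constraints hold, and each of these gives
    [dot v (c i) / b i <= s^-1]. Applied to [v] and [- v], this bounds the vectors [(b i)^-1 *: c i]
    pointwise, hence uniformly by some [M]; then [e] is [M^-1]. *)
Lemma halfspaces_gap (I : Type) (J : set I) (c : I -> H) (b : I -> R) :
  (forall i, J i -> 0 < b i) ->
  (forall v, v != 0 ->
     exists2 s, 0 < s & finite_set [set i | J i /\ b i < s * dot v (c i)]) ->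
  exists2 e, 0 < e & forall i, J i -> e * `|c i| <= b i.
Proof.
move=> b0 Jfin.
have bnd v : exists M, forall i, J i -> dot v ((b i)^-1 *: c i) <= M.
  have [->|v0] := eqVneq v 0; first by exists 0 => i _; rewrite (dot0l dotP).
  have [s s0 /(finite_set_bound (fun i => dot v ((b i)^-1 *: c i)))[M M0 MP]] := Jfin v v0.
  exists (M + s^-1) => i Ji; have [bi|bi] := ltP (b i) (s * dot v (c i)).
    by rewrite (le_trans (MP i _))// lerDl invr_ge0 ltW.
  apply: (@le_trans _ _ s^-1); last by rewrite lerDr ltW.
  by rewrite (dotZr dotP) ler_pdivrMl ?b0// ler_pdivlMr// mulrC.
have [|M M0 MP] := @dot_banach_steinhaus _ _ dot I J (fun i => (b i)^-1 *: c i) dotP.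
  move=> v; have [[M1 M1P] [M2 M2P]] := (bnd v, bnd (- v)).
  exists (Num.max M1 M2) => i Ji; rewrite ler_norml le_max M1P// andbT.
  by rewrite lerNl le_max -(dotNl dotP) M2P// orbT.
exists M^-1; first by rewrite invr_gt0.
move=> i Ji; have := MP i Ji.
by rewrite normrZ normfV gtr0_norm ?b0// ler_pdivrMl ?b0// ler_pdivrMl// mulrC.
Qed.

Lemma orthonormal_sequence (V : set H) (d : nat -> H) :
  (forall L : seq H, exists u,
     [/\ V u, `|u| = 1 & forall l, l \in L -> dot u l = 0]) ->
  exists u : nat -> H, forall n,
    [/\ V (u n), `|u n| = 1, forall k, (k <= n)%N -> dot (u n) (d k) = 0
      & forall k, (k < n)%N -> dot (u n) (u k) = 0].
Proof.
move=> /choice[pick pickP].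
(* [dl n] includes [d n] itself; [S n] lists the [n] vectors already picked. *)
pose dl n := [seq d k | k <- iota 0 n.+1].
pose S := fix S n := if n is m.+1 then pick (S m ++ dl m) :: S m else [::].
have uS k n : (k < n)%N -> pick (S k ++ dl k) \in S n.
  elim: n => // n IH; rewrite ltnS leq_eqVlt => /predU1P[->|kn].
    by rewrite /= mem_head.
  by rewrite /= inE IH ?orbT.
exists (fun n => pick (S n ++ dl n)) => n.
have [Vu u1 uL] := pickP (S n ++ dl n); split=> // k kn; apply: uL.
  by rewrite mem_cat map_f ?orbT// mem_iota.
by rewrite mem_cat uS.
Qed.

(** By Pythagoras, squared distances between points of the walk are increments of [|y n| ^+ 2], a
    nondecreasing sequence bounded by [T]; so the walk is Cauchy. *)
Lemma orthogonal_steps_cvg (y u : nat -> H) (t : nat -> R) (T : R) :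
  (forall n, y n.+1 = y n + t n *: u n) -> y 0 = 0 ->
  (forall n, `|u n| = 1) -> (forall n k, (k < n)%N -> dot (u n) (u k) = 0) ->
  (forall n, `|y n| ^+ 2 < T) ->
  exists z, [/\ y @ \oo --> z, forall n, `|z| ^+ 2 = `|y n| ^+ 2 + `|z - y n| ^+ 2
              & `|z| ^+ 2 <= T].
Proof.
move=> yS y0 u1 uo yT.
have yu n m : (n <= m)%N -> dot (y n) (u m) = 0.
  elim: n => [|n IH] nm; first by rewrite y0 (dot0l dotP).
  by rewrite yS (dotDl dotP) (dotZl dotP) (dotC dotP (u n)) uo// IH ?mulr0 ?addr0// ltnW.
have yy n k : dot (y (n + k)%N) (y n) = `|y n| ^+ 2.
  elim: k => [|k IH]; first by rewrite addn0 (dotxx dotP).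
  by rewrite addnS yS (dotDl dotP) IH (dotZl dotP) (dotC dotP) yu ?leq_addr// mulr0 addr0.
have yd n m : (n <= m)%N -> `|y m - y n| ^+ 2 = `|y m| ^+ 2 - `|y n| ^+ 2.
  by move=> /subnKC<-; rewrite (sqr_normB dotP) yy; ring.
pose s : R^nat := fun n => `|y n| ^+ 2.
have sub : has_sup (range s).
  by split; [exists (s 0); exists 0 | exists T => _ [n _ <-]; exact/ltW/yT].
have /cauchy_cvgP/cvg_ex[z yz] : cauchy (y @ \oo).
  apply: cauchy_exP => e e0.
  have [_ [N _ <-] sN] := sup_adherent (exprn_gt0 2 e0) sub.
  exists (y N); exists N => // m /= Nm; rewrite -ball_normE /= distrC.
  rewrite -(@ltr_pXn2r _ 2)// ?nnegrE ?(ltW e0)// yd//.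
  have : s m <= sup (range s) by apply: ub_le_sup; [case: sub | exists m].
  rewrite /s in sN *; lra.
have zP n : `|z| ^+ 2 = `|y n| ^+ 2 + `|z - y n| ^+ 2.
  have zy : dot z (y n) = `|y n| ^+ 2.
    by apply: (dot_cst dotP yz (N := n)) => m /subnKC <-.
  by rewrite (sqr_normB dotP) zy; ring.
exists z; split => //; rewrite leNgt; apply/negP => Tz.
have e0 : 0 < Num.sqrt (`|z| ^+ 2 - T) by rewrite sqrtr_gt0 subr_gt0.
have /cvgrPdist_lt/(_ _ e0)[N _ /(_ N (leqnn _))/=] := yz.
rewrite -(@ltr_pXn2r _ 2)// ?nnegrE ?sqrtr_ge0// (@sqr_sqrtr _ (`|z| ^+ 2 - T)) ?subr_ge0 1?ltW//.
by have := zP N; have := yT N; lra.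
Qed.

(* Walk from the origin along the orthonormal directions, each time (up to a
   factor) as far as the ball of squared radius T and the half-spaces allow.
   The k-th half-space is orthogonal to all but finitely many steps, so the limit
   stays strictly outside of it; the walk can only stall on the sphere, since
   elsewhere there would be a gap. *)
Lemma greedy_walk (I : Type) (J : set I) (en : nat -> I) (c : I -> H)
    (b : I -> R) (u : nat -> H) (T : R) :
  J `<=` range en -> 0 < T -> (forall i, J i -> 0 < b i) ->
  (forall n, `|u n| = 1) -> (forall n k, (k < n)%N -> dot (u n) (u k) = 0) ->
  (forall n k, (k <= n)%N -> dot (u n) (c (en k)) = 0) ->
  (forall z, `|z| ^+ 2 < T -> (forall i, J i -> 0 < b i - dot z (c i)) ->
     exists2 e, 0 < e & forall i, J i -> e * `|c i| <= b i - dot z (c i)) ->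
  exists t : nat -> R, exists z, [/\ \sum_(k < n) t k *: u k @[n --> \oo] --> z,
    `|z| ^+ 2 = T & forall i, J i -> 0 < b i - dot z (c i)].
Proof.
move=> Jen T0 b0 u1 uo uc gap.
pose valid z := `|z| ^+ 2 < T /\ forall i, J i -> 0 < b i - dot z (c i).
(* Admissible lengths: an orthogonal step of length [e] stays in the closed ball of squared radius
   [T], and no step of length [e] crosses a bounding hyperplane. *)
pose adm z e := e ^+ 2 <= T - `|z| ^+ 2 /\
  forall i, J i -> e * `|c i| <= b i - dot z (c i).
have adm_ex z : valid z -> exists2 e, 0 < e & adm z e.
  move=> [zT zc]; have [e e0 ec] := gap z zT zc.
  pose d := Num.sqrt (T - `|z| ^+ 2).
  have d0 : 0 < d by rewrite sqrtr_gt0 subr_gt0.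
  exists (Num.min e d); first by rewrite lt_min e0.
  split=> [|i Ji].
    have <- : d ^+ 2 = T - `|z| ^+ 2 by rewrite sqr_sqrtr// subr_ge0 ltW.
    by rewrite ler_pXn2r ?nnegrE ?ge_min ?lexx ?orbT// ?le_min !ltW.
  by apply: le_trans (ec i Ji); rewrite ler_wpM2r// ge_min lexx.
(* The step [t] is a quarter of a near-maximal admissible [e]. As [4 * t] is admissible, a step of
   length [t] keeps all inequalities strict; and no admissible length exceeds [2 * e = 8 * t]. *)
have /choice[st stP] z : exists t, valid z ->
    [/\ 0 < t, adm z (4 * t) & forall e, adm z e -> e <= 8 * t].
  have [/adm_ex zv|nz] := pselect (valid z); last by exists 0.
  have [e [eT _]|e e0 [eadm emax]] := near_maximal (M := Num.sqrt T) zv.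
    have [e0|/ltW e0] := leP e 0; first by have := sqrtr_ge0 T; lra.
    rewrite -(@ler_pXn2r _ 2)// ?nnegrE ?sqrtr_ge0// (sqr_sqrtr (ltW T0)).
    by apply: le_trans eT _; rewrite gerBl sqr_ge0.
  exists (e / 4) => _; split; first by rewrite divr_gt0.
    by rewrite mulrC divfK.
  by move=> e' /emax; lra.
pose y := fix y n := if n is m.+1 then y m + st (y m) *: u m else 0.
pose t n := st (y n).
have yE n : y n = \sum_(k < n) t k *: u k.
  by elim: n => [|n IH]; rewrite ?big_ord0// big_ord_recr /= -IH.
have yu n m : (n <= m)%N -> dot (y n) (u m) = 0.
  elim: n => [|n IH] nm; first by rewrite (dot0l dotP).
  by rewrite /= (dotDl dotP) (dotZl dotP) (dotC dotP (u n)) uo// IH ?mulr0 ?addr0// ltnW.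
have yvalid n : valid (y n).
  elim: n => [|n IH].
    by split=> [|i Ji]; rewrite /= ?normr0 ?expr0n// (dot0l dotP) subr0 b0.
  have [t0 [tT tc] _] := stP _ IH; split=> [|i Ji].
    rewrite /= (sqr_normD dotP) (dotZr dotP) yu// (sqr_normM) u1 expr1n.
    have : 0 < st (y n) ^+ 2 by rewrite exprn_gt0.
    by move: tT; rewrite exprMn; lra.
  have := tc i Ji; have := dot_le dotP (u n) (c i); rewrite u1 mul1r => uci.
  have /ler_wpM2l/(_ _ _ uci) := ltW t0.
  have : 0 < b i - dot (y n) (c i) by case: IH => _; exact.
  by rewrite /= (dotDl dotP) (dotZl dotP); lra.
have [z [yz zP zT]] := @orthogonal_steps_cvg y u t T (fun=> erefl) erefl u1 uo
  (fun n => (yvalid n).1).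
have zc i : J i -> 0 < b i - dot z (c i).
  move=> /[dup] Ji /Jen[k _ ki]; rewrite -ki in Ji *.
  have := (yvalid k).2 _ Ji; suff -> : dot z (c (en k)) = dot (y k) (c (en k)) by [].
  apply: (dot_cst dotP yz (N := k)) => n /subnKC <-.
  elim: (n - k)%N => [|m IH]; first by rewrite addn0.
  by rewrite addnS /= (dotDl dotP) (dotZl dotP) uc ?leq_addr// mulr0 addr0.
exists t, z; split=> //; first by rewrite -(funext yE).
apply/eqP; rewrite eq_le zT leNgt; apply/negP => zltT.
(* Some [e] is admissible at [z]. Late points [y N] are within [e / 64] of [z], so [e / 2] is
   admissible there; but the step from [y N] is shorter than [e / 32], which caps admissible lengths
   below [e / 4]. *)
have [e e0 [eT ec]] := adm_ex z (conj zltT zc).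
have e16 : 0 < e / 64 by rewrite divr_gt0.
have /cvgrPdist_lt/(_ _ e16)[N _ yN] := yz.
have zN : `|z - y N| < e / 64 by apply: yN => /=.
have zN1 : `|z - y N.+1| < e / 64 by apply: yN => /=.
have [t0 _ /(_ (e / 2))] := stP _ (yvalid N).
have tE : `|y N.+1 - y N| = st (y N).
  by rewrite /= addrAC subrr add0r normrZ u1 mulr1 gtr0_norm.
have tN : st (y N) < e / 32.
  have := ler_normD (y N.+1 - z) (z - y N).
  by rewrite subrKA tE (distrC (y N.+1)); lra.
have admN : adm (y N) (e / 2).
  split=> [|i Ji].
    have := zP N; have := sqr_ge0 `|z - y N|; have := sqr_ge0 e.
    by rewrite exprMn; lra.
  have := ec i Ji; have := dot_le dotP (y N - z) (c i); rewrite distrC in zN.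
  have /ler_wpM2r/(_ _ _ (ltW zN)) := normr_ge0 (c i).
  by rewrite (dotDl dotP) (dotNl dotP); have := mulr_ge0 (ltW e0) (normr_ge0 (c i)); lra.
by move=> /(_ admN); lra.
Qed.

End halfspaces.

(** Common form of open, closed and degenerate balls; [r = 0] forces [A = [set c]]. *)
Definition ball_like (R : realType) (H : normedModType R) (A : set H)
    (c : H) (r : R) : Prop :=
  [/\ 0 <= r, A c, forall y, `|y - c| < r -> A y
    & forall y, A y -> `|y - c| <= r].

(** * Escaping countably many balls *)

Section escape.
Context (R : realType) (H : completeNormedModType R) (dot : H -> H -> R).
Hypothesis dotP : inner_product dot.

Lemma countable_meeting (T : Type) (B : set (set T)) (D : set T) :
  point_finite B -> countable D -> countable [set A | B A /\ A `&` D !=set0].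
Proof.
move=> Bfin Dc.
apply: (@sub_countable _ _ _ (\bigcup_(d in D) [set A | B A /\ A d])).
  by apply: subset_card_le => A [BA [d [Ad Dd]]]; exists d.
by apply: bigcup_countable => // d _; exact: finite_set_countable.
Qed.

(* On the sphere of squared radius T around x0, a ball with center c and radius
   r is the slice cut out by the half-space
     dot z (c - x0) >= (T + |x0 - c|^2 - r^2) / 2,
   and these half-spaces miss the center once T is large. *)
Lemma escape (B B' : set (set H)) (V : set H) (x0 e : H) :
  (forall A, B A -> exists c r, ball_like A c r) -> point_finite B ->
  B' `<=` B -> countable B' ->
  V x0 -> (forall a x y, V x -> V y -> V (a *: x + y)) ->
  (forall L : seq H, exists u,
     [/\ V u, `|u| = 1 & forall l, l \in L -> dot u l = 0]) ->
  exists x, [/\ forall A, B' A -> ~ A x, dot (x - x0) e = 0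
    & exists2 v : nat -> H, forall n, V (v n) & v @ \oo --> x].
Proof.
move=> Bball Bfin B'B B'c Vx0 Vlin Vinf.
have /choice[cr crP] A : exists p : H * R, B A -> ball_like A p.1 p.2.
  have [/Bball[c [r Acr]]|nBA] := pselect (B A); first by exists (c, r).
  by exists (0, 0).
(* The power of [x] with respect to the sphere bounding [A]. *)
pose pow A x : R := `|x - (cr A).1| ^+ 2 - (cr A).2 ^+ 2.
have pow_lt0 A x : B A -> pow A x < 0 -> A x.
  by move=> /crP[r0 _ Ain _] Ax; apply: Ain; move: Ax; rewrite subr_lt0 ltr_pXn2r// ?nnegrE.
have pow_le0 A x : B A -> A x -> pow A x <= 0.
  move=> /crP[r0 _ _ +] Ax => /(_ _ Ax).
  by rewrite subr_le0 ler_pXn2r// ?nnegrE.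
(* Only members with negative power at [x0] threaten [0 < b A]. They contain [x0], so they are
   finitely many and [M] controls them; the added 1 gives strictness. *)
have [M M0 MP] := finite_set_bound (fun A => - pow A x0) (Bfin x0).
pose T := M + 1; pose c A := (cr A).1 - x0; pose b A := (T + pow A x0) / 2.
have T0 : 0 < T by rewrite addr_gt0.
have b0 A : B A -> 0 < b A.
  move=> BA; rewrite divr_gt0// /T; have [/(pow_lt0 _ _ BA) Ax0|] := ltP (pow A x0) 0.
    by have := MP A (conj BA Ax0); lra.
  by move: M0; lra.
have powE A z : `|z| ^+ 2 = T -> pow A (x0 + z) = 2 * (b A - dot z (c A)).
  move=> zT; rewrite /pow /b -zT /pow (_ : x0 + z - _ = z - c A); last first.
    by rewrite /c opprB addrCA addrA.
  have -> : `|x0 - (cr A).1| = `|c A| by rewrite distrC.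
  rewrite (sqr_normB dotP); set p := dot _ _; set q := `|c A|; lra.
have [en enP] : exists en : nat -> set H, B' `<=` range en.
  by have /pcard_surjP[en en_surj] := B'c; exists en.
(* Index 0 is spent on [e], so the walk uses [u n.+1], orthogonal to [e] and to [c (en k)] for
   [k <= n]. *)
pose d k := if k is j.+1 then c (en j) else e.
have [u uP] := orthonormal_sequence d Vinf.
have gap z : `|z| ^+ 2 < T -> (forall A, B' A -> 0 < b A - dot z (c A)) ->
    exists2 eps, 0 < eps & forall A, B' A -> eps * `|c A| <= b A - dot z (c A).
  move=> zT zb; apply: (halfspaces_gap dotP) => // v v0.
  have [s s0 sT] := ray_meets_sphere dotP v0 zT; exists s => //.
  apply: sub_finite_set (Bfin (x0 + (z + s *: v))) => A [/B'B BA bA].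
  split=> //; apply: pow_lt0 => //.
  by rewrite powE// (dotDl dotP) (dotZl dotP); lra.
have [||||t [z [tz zT zb]]] :=
  @greedy_walk _ _ _ dotP _ B' en c b (fun n => u n.+1) T enP T0 _ _ _ _ gap.
- by move=> A /B'B/b0.
- by move=> n; have [] := uP n.+1.
- by move=> n k kn; have [_ _ _ ->] := uP n.+1.
- by move=> n k kn; have [_ _ /(_ k.+1) ->] := uP n.+1.
exists (x0 + z); split.
- move=> A B'A /(pow_le0 _ _ (B'B _ B'A)).
  by rewrite powE//; have := zb _ B'A; lra.
- rewrite addrAC subrr add0r; apply: (dot_cst dotP tz (N := 0)) => n _.
  elim/big_ind: _ => [|x y xe ye|k _]; first by rewrite (dot0l dotP).
    by rewrite (dotDl dotP) xe ye addr0.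
  by rewrite (dotZl dotP); have [_ _ /(_ 0) ->] := uP k.+1; rewrite ?mulr0.
- exists (fun n => x0 + \sum_(k < n) t k *: u k.+1); last by apply: cvgD => //; exact: cvg_cst.
  elim=> [|n IH]; first by rewrite big_ord0 addr0.
  by rewrite big_ord_recr /= addrA addrC; apply: Vlin => //; have [] := uP n.+1.
Qed.

(** Gram-Schmidt by induction on [L]: the residual [x'] of [x] loses its component along the
    residual [l'] of the new vector. [L] may be dependent: for [l' = 0] there is nothing to
    remove. *)
Lemma orthogonal_projection (L : seq H) (x : H) : exists a : nat -> R,
  forall l, l \in L -> dot (x - \sum_(i < size L) a i *: L`_i) l = 0.
Proof.
elim: L x => [|l L IH] x; first by exists (fun=> 0).
have [[a aP] [b bP]] := (IH x, IH l).
set x' := x - _ in aP; set l' := l - _ in bP.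
pose k := dot x' l' / dot l' l'.
have kl : dot (x' - k *: l') l' = 0.
  rewrite (dotDl dotP) (dotNl dotP) (dotZl dotP) /k.
  have [->|l0] := eqVneq l' 0; first by rewrite !(dot0r dotP) mulr0 subr0.
  by rewrite divfK ?subrr// (dotxx dotP) expf_eq0 /= normr_eq0.
have kL m : m \in L -> dot (x' - k *: l') m = 0.
  by move=> mL; rewrite (dotDl dotP) (dotNl dotP) (dotZl dotP) aP// bP// mulr0 subr0.
pose ab i := if i is j.+1 then a j - k * b j else k.
exists ab => m; rewrite (_ : x - _ = x' - k *: l'); last first.
  have -> : \sum_(i < size (l :: L)) ab i *: (l :: L)`_i =
      k *: l + (\sum_(i < size L) a i *: L`_i - k *: \sum_(i < size L) b i *: L`_i).
    rewrite big_ord_recl; congr (_ + _); rewrite scaler_sumr -sumrB.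
    by apply: eq_bigr => i _; rewrite /= scalerBl scalerA.
  rewrite /x' /l' scalerBr opprD !opprB -!addrA; congr (_ + _).
  by rewrite [LHS]addrCA [RHS]addrCA; congr (_ + _); rewrite addrC.
rewrite inE => /predU1P[->|/kL//].
rewrite -[l](subrK (\sum_(i < size L) b i *: L`_i)) -/l' (dotDr dotP) kl add0r.
elim/big_ind: _ => [|y z ye ze|i _]; first by rewrite (dot0r dotP).
  by rewrite (dotDr dotP) ye ze addr0.
by rewrite (dotZr dotP) kL ?mulr0// mem_nth.
Qed.

Lemma unit_orthogonal (L : seq H) : infinite_dimensional H ->
  exists u : H, `|u| = 1 /\ forall l, l \in L -> dot u l = 0.
Proof.
move=> Hinf; apply: contrapT => nu; apply: Hinf.
exists (size L), (fun i => L`_i) => x.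
have [a aP] := orthogonal_projection L x; exists (fun i => a i).
apply/eqP; rewrite -subr_eq0; apply/negPn/negP => y0; apply: nu.
set y := x - _ in aP y0; exists (`|y|^-1 *: y); split=> [|l lL].
  by rewrite normrZ normfV normr_id mulVf ?normr_eq0.
by rewrite (dotZl dotP) aP ?mulr0.
Qed.

End escape.

(** * Cardinality of the continuum *)

Definition ternary (R : realType) (s : set nat) (n : nat) : R :=
  \sum_(k < n) ((k : nat) \in s)%:R * 3 ^- k.

Lemma ternary_tail (R : realType) (s : set nat) m j :
  ternary R s (m.+1 + j) <= ternary R s m.+1 + 3 ^- m * (1 - 3 ^- j) / 2.
Proof.
elim: j => [|j IH]; first by rewrite addn0 expr0 invr1 subrr mulr0 mul0r addr0.
rewrite addnS /ternary big_ord_recr /= -/(ternary R s _).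
apply: le_trans (lerD IH (_ : _ <= 3 ^- (m.+1 + j))) _.
  by rewrite ler_piMl ?invr_ge0 ?exprn_ge0// lern1 leq_b1.
rewrite -addrA lerD2l exprD !exprS !invfM; set p := 3 ^- m; set q := 3 ^- j.
by rewrite le_eqVlt; apply/orP; left; apply/eqP; field.
Qed.

(** With digits 0 and 1 in base 3, the first difference is worth [3 ^- m], all later digits together
    at most half of that. *)
Lemma ternary_lt (R : realType) (s s' : set nat) m :
  (forall k, (k < m)%N -> (k \in s) = (k \in s')) -> m \in s -> m \notin s' ->
  sup (range (ternary R s')) < sup (range (ternary R s)).
Proof.
move=> eq_below ms ms'; have p0 : 0 < (3 ^- m : R) by rewrite invr_gt0 exprn_gt0.
have tail (s0 : set nat) n : ternary R s0 n <= ternary R s0 m.+1 + 3 ^- m / 2.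
  apply: (@le_trans _ _ (ternary R s0 (m.+1 + n))).
    rewrite /ternary [leRHS](bigID (fun k : 'I_(m.+1 + n) => (k < n)%N)) /=.
    rewrite -(big_ord_widen _ (fun k => (k \in s0)%:R * 3 ^- k)) ?leq_addl//.
    by rewrite lerDl sumr_ge0// => k _; rewrite mulr_ge0 ?invr_ge0 ?exprn_ge0.
  apply: le_trans (ternary_tail _ _ _ _) _.
  rewrite lerD2l ler_pM2r// ler_piMr ?ltW// gerBl invr_ge0 exprn_ge0//.
have sE : ternary R s m.+1 = ternary R s' m.+1 + 3 ^- m.
  rewrite /ternary !big_ord_recr /= ms (negbTE ms') mul1r mul0r addr0; congr (_ + _).
  by apply: eq_bigr => k _; rewrite eq_below.
have s'_le : sup (range (ternary R s')) <= ternary R s' m.+1 + 3 ^- m / 2.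
  by apply: ge_sup; [exists (ternary R s' 0); exists 0 | move=> _ [n _ <-]].
have s_ge : ternary R s m.+1 <= sup (range (ternary R s)).
  apply: ub_le_sup; last by exists m.+1.
  by exists (ternary R s m.+1 + 3 ^- m / 2) => _ [n _ <-].
by apply: le_lt_trans s'_le (lt_le_trans _ s_ge); rewrite sE; lra.
Qed.

Lemma set_nat_injects_in_reals (R : realType) : exists f : set nat -> R, injective f.
Proof.
exists (fun s => sup (range (ternary R s))) => s s' fss'.
apply: contrapT => ss'.
have [m mP] : exists m, (m \in s) != (m \in s').
  apply: contrapT => nm; apply: ss'; apply/seteqP; split=> k ks; apply: contrapT => nks;
    apply: nm; exists k; [rewrite (mem_set ks) memNset//|rewrite (mem_set ks) memNset//].
have /ex_minnP[{mP}m mP m_min] : exists m, (m \in s) != (m \in s') by exists m.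
have below k : (k < m)%N -> (k \in s) = (k \in s').
  by move=> km; apply/eqP/negPn/negP => /m_min; rewrite leqNgt km.
have [ms|ms] := boolP (m \in s); have [ms'|ms'] := boolP (m \in s').
- by rewrite ms ms' in mP.
- by have := ternary_lt R below ms ms'; rewrite fss' ltxx.
- have := @ternary_lt R s' s m (fun k km => esym (below k km)) ms' ms.
  by rewrite fss' ltxx.
- by rewrite (negbTE ms) (negbTE ms') in mP.
Qed.

Lemma injective_card_le (T U : Type) (B : set U) (f : T -> U) :
  injective f -> (forall x, B (f x)) -> [set: T] #<= B.
Proof.
move=> f_inj fB; have fT : f @` [set: T] #= [set: T].
  by apply: inj_card_eq => x y _ _; exact: f_inj.
by rewrite -(card_le_eql fT); apply: subset_card_le => _ [x _ <-].
Qed.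

Lemma infinite_set_sequence (T : Type) :
  infinite_set [set: T] -> exists f : nat -> T, injective f.
Proof.
move=> /infiniteP/card_leP[f].
exists (fun n => val (f (SigSub (mem_set (I : [set: nat] n))))) => m n.
move=> /val_inj/(@inj _ _ _ f) E.
by have /(congr1 val) := E (mem_set I) (mem_set I).
Qed.

(* Koenig: if the m-th coordinate of the m-th piece of a countable cover of
   (set nat)^nat missed some value for each m, the diagonal of these values would
   escape the cover; so some piece surjects onto set nat. *)
Lemma countable_fibers_card_le (T : Type) (g : set nat -> T) :
  (forall x, countable (g @^-1` [set x])) -> [set: set nat] #<= [set: T].
Proof.
move=> gc.
have /choice[j jP] x : exists j : set nat -> nat, {in g @^-1` [set x] &, injective j}.
  exact/countable_injP.
(* Two sets of one piece with the same image have the same index in that fiber, so [g] is injective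
   on each piece. [row] reads a set of naturals as a sequence of such sets. *)
pose piece n := [set s | j (g s) s = n].
pose row (n : nat) (s : set nat) : set nat := [set m | s (choice.pickle (n, m))].
have [[n rowP]|nsurj] := pselect (exists n, forall y, exists2 s, piece n s & row n s = y).
  have /choice[h hP] y : exists s, piece n s /\ row n s = y.
    by have [s] := rowP y; exists s.
  have ghK : injective (g \o h).
    move=> y z /= gyz; have [[py ry] [pz rz]] := (hP y, hP z); rewrite -ry -rz; congr (row n _).
    apply: (jP (g (h y))); rewrite ?inE//= ?gyz//.
    by move: py pz; rewrite /piece /= -gyz => -> ->.
  by apply: injective_card_le ghK _.
have /choice[y yP] n : exists y, forall s, piece n s -> row n s <> y.
  apply: contrapT => ny; apply: nsurj; exists n => y.
  by apply: contrapT => nex; apply: ny; exists y => s ps rs; apply: nex; exists s.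
pose s := [set k | exists n m : nat, k = choice.pickle (n, m) /\ y n m].
have rowE n : row n s = y n.
  apply/seteqP; split=> m /=; last by move=> ynm; exists n, m.
  by move=> [n' [m' [/(pcan_inj (@choice.pickleK _))[-> ->]]]].
by have := yP (j (g s) s) s erefl; rewrite rowE.
Qed.

(** Points of [P] are coded by tagged singletons, the others by tagged copies of their code; the
    tags keep the two kinds apart. *)
Lemma countable_setU_card_le (T : Type) (P Q : set T) :
  countable P -> Q #<= [set: set nat] -> P `|` Q #<= [set: set nat].
Proof.
move=> /countable_injP[f f_inj] /pcard_injP[g g_inj].
pose h x : set nat := if x \in P then [set choice.pickle (inl nat (f x))]
  else [set choice.pickle (inr nat n) | n in g x].
apply/pcard_injP; exists h => x y; rewrite !inE /h.
have disj (a : nat) (X : set nat) : [set choice.pickle (inl nat a)] <>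
    [set choice.pickle (inr nat n) | n in X].
  move=> /seteqP[/(_ _ erefl)[n _ E] _].
  by have := pcan_inj (@choice.pickleK (nat + nat)%type) E.
have [xP|xP] := boolP (x \in P); have [yP|yP] := boolP (y \in P) => PQx PQy E.
- apply: f_inj => //; move/seteqP: E => [/(_ _ erefl)/= + _].
  by move=> /(pcan_inj (@choice.pickleK _))[].
- by have := disj _ _ E.
- by have := disj _ _ (esym E).
- rewrite !notin_setE in xP yP; case: PQx => // Qx; case: PQy => // Qy.
  apply: g_inj; rewrite ?inE//.
  have sub a b : [set choice.pickle (inr nat n) | n in g a] `<=`
      [set choice.pickle (inr nat n) | n in g b] -> g a `<=` g b.
    move=> ab n gan; have [m gbm mn] := ab _ (ex_intro2 _ _ n gan erefl).
    by have [<-] := pcan_inj choice.pickleK mn.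
  by apply/seteqP; split; apply: sub; rewrite E.
Qed.

(** A point is determined by the pairs [(d, n)] for which [d] in [D] is within [n.+1%:R^-1] of
    it. *)
Lemma separable_card_le (R : realType) (H : normedModType R) :
  separable H -> [set: H] #<= [set: set nat].
Proof.
move=> [D /countable_injP[f f_inj] Dd].
pose near x d n := D d /\ `|x - d| < n.+1%:R^-1.
pose g x : set nat := [set choice.pickle (f p.1, p.2) | p in [set p | near x p.1 p.2]].
apply/pcard_injP; exists g => x y _ _ gxy; apply: contrapT => xy.
have e0 : 0 < `|x - y| / 2 by rewrite divr_gt0// normr_gt0 subr_eq0; exact/eqP.
have [n n0] : exists n : nat, n.+1%:R^-1 < `|x - y| / 2.
  have [n _ /(_ n (leqnn n))/= nP] := near_infty_natSinv_lt (PosNum e0).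
  by exists n.
have [d [xd Dd']] : ball x (n.+1%:R^-1) `&` D !=set0.
  apply: Dd; last exact: ball_open.
  by exists x; apply: ballxx; rewrite invr_gt0.
have [[d' m] [/= Dd'' yd] /(pcan_inj (@choice.pickleK _))[fd mn]] : g y (choice.pickle (f d, n)).
  by rewrite -gxy; exists (d, n) => //; split=> //=; move: xd; rewrite -ball_normE.
have dd' : d' = d by apply: f_inj; rewrite ?inE.
rewrite dd' mn in yd; rewrite -ball_normE /= in xd.
have := ler_normD (x - d) (d - y); rewrite subrKA (distrC d).
by move: xd yd n0; move: (_^-1) => e; lra.
Qed.

(** * Separable subspaces spanned by an orthonormal sequence *)

Section rational_span.
Context (R : realType) (H : completeNormedModType R) (dot : H -> H -> R).
Hypothesis dotP : inner_product dot.
Variable u : nat -> H.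
Hypothesis uP : forall i j, dot (u i) (u j) = (i == j)%:R.

Let comb (s : seq (R * nat)) : H := \sum_(p <- s) p.1 *: u p.2.

(** A countable set whose closure contains the real span. Indices may repeat in a list, so sums are
    concatenations. *)
Definition rational_span : set H :=
  range (fun s : seq (rat * nat) => \sum_(p <- s) ratr p.1 *: u p.2).

Lemma countable_rational_span : countable rational_span.
Proof.
apply: (@sub_countable _ _ _ [set: seq (rat * nat)]); first exact: card_image_le.
exact: countableP.
Qed.

Lemma rational_span_midpoint x y :
  rational_span x -> rational_span y -> rational_span (2^-1 *: (x + y)).
Proof.
move=> [s _ <-] [s' _ <-]; exists [seq (2^-1 * p.1, p.2) | p <- s ++ s'] => //.
rewrite -big_cat big_map scaler_sumr; apply: eq_bigr => p _ /=.
by rewrite rmorphM /= fmorphV /= ratr_nat scalerA.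
Qed.

Let normu i : `|u i| = 1.
Proof.
have : `|u i| ^+ 2 = 1 by rewrite -(dotxx dotP) uP eqxx.
by move/eqP; rewrite sqrf_eq1 => /orP[/eqP//|/eqP ui]; have := normr_ge0 (u i); rewrite ui; lra.
Qed.

Let rational_span_approx s e : 0 < e -> exists2 d, rational_span d & `|comb s - d| < e.
Proof.
elim: s e => [|[a k] s IH] e e0.
  by exists 0; [exists [::]; rewrite ?big_nil | rewrite /comb big_nil subrr normr0].
have [|_ [q _ <-] sq] := IH (e / 2); first by rewrite divr_gt0.
have [r] : exists r, ratr r \in `]a, a + e / 2[.
  by have [|r] := @rat_in_itvoo R a (a + e / 2); [rewrite ltrDl divr_gt0 | exists r].
rewrite in_itv /= => /andP[ar re].
exists (\sum_(p <- (r, k) :: q) ratr p.1 *: u p.2); first by exists ((r, k) :: q).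
rewrite /comb !big_cons /= opprD addrACA -scalerBl (le_lt_trans (ler_normD _ _))//.
have : `|(a - ratr r) *: u k| < e / 2.
  by rewrite normrZ normu mulr1 distrC gtr0_norm ?subr_gt0//; lra.
by rewrite /comb in sq; move: sq; lra.
Qed.

(** Orthogonality to [L] puts [size L] linear equations on [(size L).+1] coefficients; a nonzero
    solution gives [w != 0] by orthonormality. *)
Let comb_orthogonal (L : seq H) : exists w : H,
  [/\ range comb w, `|w| = 1 & forall l, l \in L -> dot w l = 0].
Proof.
pose A := \matrix_(i < (size L).+1, j < size L) dot (u i) L`_j.
have : kermx A != 0.
  by rewrite kermx_eq0 /row_free neq_ltn ltnS rank_leq_col.
move=> /rowV0Pn[v /sub_kermxP vA v0].
pose w := \sum_(i < (size L).+1) v 0 i *: u i.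
have wu (i : 'I_(size L).+1) : dot w (u i) = v 0 i.
  rewrite /w; transitivity (\sum_(j < (size L).+1) v 0 j * (j == i)%:R); last first.
    rewrite (bigD1 i) //= eqxx mulr1 big1 ?addr0// => j /negbTE ->; exact: mulr0.
  elim/big_ind2: _ => [|x a y b <- <-|j _]; first by rewrite (dot0l dotP).
    by rewrite (dotDl dotP).
  by rewrite (dotZl dotP) uP.
have w0 : w != 0.
  apply: contra_neq v0 => w0; apply/rowP => i.
  by rewrite mxE -wu w0 (dot0l dotP).
have cw a : range comb (a *: w).
  exists [seq (a * v 0 i, i : nat) | i <- enum 'I_(size L).+1] => //.
  rewrite /comb big_map big_enum scaler_sumr; apply: eq_bigr => i _.
  by rewrite scalerA.
exists (`|w|^-1 *: w); split=> [//||l lL].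
  by rewrite normrZ normfV normr_id mulVf ?normr_eq0.
suff wl : dot w l = 0 by rewrite (dotZl dotP) wl mulr0.
have jL : (index l L < size L)%N by rewrite index_mem.
have := congr1 (fun M : 'rV_(size L) => M 0 (Ordinal jL)) vA; rewrite !mxE => <-.
rewrite /w; elim/big_ind2: _ => [|x a y b xa yb|j _]; first by rewrite (dot0l dotP).
  by rewrite (dotDl dotP) xa yb.
by rewrite (dotZl dotP) mxE /= nth_index.
Qed.

(** By point-finiteness only countably many members meet the rational span; the walk avoids them
    from [t *: u 0], orthogonally to [u 0] and inside the real span. *)
Lemma escape_rational_span (B : set (set H)) (t : R) :
  (forall A, B A -> exists c r, ball_like A c r) -> point_finite B ->
  exists x, [/\ forall A, B A -> A `&` rational_span !=set0 -> ~ A x,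
    dot x (u 0) = t
    & forall e, 0 < e -> exists2 d, rational_span d & `|x - d| < e].
Proof.
move=> Bball Bfin.
have combZ s a : comb [seq (a * p.1, p.2) | p <- s] = a *: comb s.
  by rewrite /comb big_map scaler_sumr; apply: eq_bigr => p _; rewrite scalerA.
have [|||||x [xB xt [v vV vx]]] := @escape _ _ _ dotP B
  [set A | B A /\ A `&` rational_span !=set0] (range comb) (t *: u 0) (u 0) Bball Bfin.
- by move=> A [].
- exact: countable_meeting Bfin countable_rational_span.
- by exists [:: (t, 0)] => //; rewrite /comb big_seq1.
- move=> a _ _ [s _ <-] [s' _ <-]; exists ([seq (a * p.1, p.2) | p <- s] ++ s') => //.
  by rewrite -combZ /comb big_cat.
- exact: comb_orthogonal.
exists x; split=> [A BA AD|| e e0]; first exact: xB.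
  by apply/eqP; rewrite -subr_eq0 -xt (dotDl dotP) (dotNl dotP) (dotZl dotP) uP eqxx mulr1.
have e2 : 0 < e / 2 by rewrite divr_gt0.
have /cvgrPdist_lt/(_ _ e2)[N _ /(_ N (leqnn N))/= xN] := vx.
have [s _ sv] := vV N; have [d Dd sd] := rational_span_approx s e2.
exists d => //; have := ler_normD (x - v N) (v N - d); rewrite subrKA -sv in xN sd *.
by lra.
Qed.

End rational_span.

Lemma ball_like_ball (R : realType) (H : normedModType R) (c : H) (r : R) :
  0 < r -> ball_like (ball c r) c r.
Proof.
move=> r0; rewrite -ball_normE; split=> [||y|y]; first exact: ltW.
- by rewrite /= subrr normr0.
- by rewrite /= distrC.
- by rewrite /= distrC => /ltW.
Qed.

Lemma ball_like_closed_ball (R : realType) (H : normedModType R) (c : H) (r : R) :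
  0 <= r -> ball_like (closed_ball_ Num.norm c r) c r.
Proof.
by move=> r0; split=> // [|y|y]; rewrite /closed_ball_ /= ?subrr ?normr0// distrC// => /ltW.
Qed.

(** * Coordinates in [l2] *)

Lemma sumsq_split (R : realType) (I : choiceType) (f : I -> R) (i : I) :
  (sumsq f = (f i ^+ 2)%:E + \esum_(j in ~` [set i]) (f j ^+ 2)%:E)%E.
Proof.
have f0 j : (0 <= (f j ^+ 2)%:E)%E by rewrite lee_fin sqr_ge0.
by rewrite /sumsq (esumID [set i])// setTI esum_set1// setTI.
Qed.

Section l2_delta.
Context (R : realType) (I : choiceType).

Definition delta_fun (i : I) : I -> R := fun j => (j == i)%:R.

Lemma delta_funP i : delta_fun i \in @l2_pred R I.
Proof.
rewrite inE (sumsq_split _ i) /delta_fun eqxx expr1n esum1 ?adde0 ?ltry// => j /= /eqP.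
by move=> /negbTE ->; rewrite expr0n.
Qed.

Definition l2_delta (i : I) : l2 R I := L2 (delta_funP i).

(** By polarization: [x + l2_delta i] and [x - l2_delta i] differ only in coordinate [i], so the
    common finite tail [t] cancels. *)
Lemma dot_delta (dot : l2 R I -> l2 R I -> R) (x : l2 R I) i :
  inner_product dot -> dot x (l2_delta i) = x i.
Proof.
move=> dotP; rewrite (polarization dotP).
set t := (\esum_(j in ~` [set i]) (x j ^+ 2)%:E)%E.
have sq (y : l2 R I) : (`|y| ^+ 2)%:E =
    ((y i ^+ 2)%:E + \esum_(j in ~` [set i]) (y j ^+ 2)%:E)%E.
  by rewrite -sumsq_split -l2_normE.
have rest (y : l2 R I) : (forall j, j != i -> y j = x j) ->
    (\esum_(j in ~` [set i]) (y j ^+ 2)%:E = t)%E.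
  by move=> yx; apply: eq_esum => j /= /eqP ji; rewrite yx.
have tfin : t \is a fin_num.
  have := sq x; rewrite -/t; case: t {rest} => //.
have rD : (`|x + l2_delta i| ^+ 2)%:E = (((x i + 1) ^+ 2)%:E + t)%E.
  rewrite sq rest; first by rewrite l2D /= /delta_fun eqxx.
  by move=> j /negbTE ji; rewrite l2D /= /delta_fun ji addr0.
have rB : (`|x - l2_delta i| ^+ 2)%:E = (((x i - 1) ^+ 2)%:E + t)%E.
  rewrite sq rest; first by rewrite l2D l2N /= /delta_fun eqxx.
  by move=> j /negbTE ji; rewrite l2D l2N /= /delta_fun ji subr0.
by move: rD rB; rewrite -(fineK tfin) -!EFinD => -[->] [->]; field.
Qed.

End l2_delta.

(** * The three assertions *)

Lemma point_finite_covering_card (R : realType) (H : completeNormedModType R)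
    (B : set (set H)) :
  hilbert_space H -> separable H -> infinite_dimensional H ->
  B `<=` open_balls H `|` closed_balls H -> covering B -> point_finite B ->
  B #= [set: set nat].
Proof.
move=> /hilbert_inner_product[dot dotP] Hsep Hinf Bballs Bcov Bfin.
have Bball A : B A -> exists c r, ball_like A c r.
  by move=> /Bballs[] [c [r r0 ->]]; exists c, r;
    [exact: ball_like_ball | exact: ball_like_closed_ball].
have [D Dc Dd] := Hsep; pose B' := [set A | B A /\ A `&` D !=set0].
have B'c : countable B' by exact: countable_meeting.
(* A ball missing the dense set [D] has radius 0. *)
have single A x : B A -> ~ B' A -> A x -> A = [set x].
  move=> BA nB'A Ax; have [c [r [r0 _ Ain Aout]]] := Bball A BA.
  have r_eq0 : r = 0.
    apply/eqP; rewrite eq_le r0 andbT leNgt; apply/negP => r_gt0; apply: nB'A.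
    split=> //; have [||d [cd Dx]] := Dd (ball c r).
    - by exists c; exact: ballxx.
    - exact: ball_open.
    by exists d; split=> //; apply: Ain; move: cd; rewrite -ball_normE /= distrC.
  have Ac y : A y -> y = c.
    by move=> /Aout; rewrite r_eq0 normr_le0 subr_eq0 => /eqP.
  by apply/seteqP; split=> y /= => [/Ac->|->//]; rewrite (Ac x).
have [e [e1 _]] := unit_orthogonal dotP [::] Hinf.
have /choice[f fP] t : exists x, (forall A, B' A -> ~ A x) /\ dot x e = t.
  have [||||x [xB' xt _]] := @escape _ _ _ dotP B B' setT (t *: e) e Bball Bfin _ B'c.
  - by move=> A [].
  - by [].
  - by [].
  - by move=> L; have [u [u1 uL]] := unit_orthogonal dotP L Hinf; exists u.
  exists x; split=> //; apply/eqP; rewrite -subr_eq0 -xt.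
  by rewrite (dotDl dotP) (dotNl dotP) (dotZl dotP) (dotxx dotP) e1 expr1n mulr1.
have [g g_inj] := set_nat_injects_in_reals R.
apply/card_eqPle; split.
- apply: (@card_le_trans _ _ _ (B' `|` range (@set1 H))).
    apply: subset_card_le => A BA; have [B'A|nB'A] := pselect (B' A); first by left.
    right; have [x [r [_ Ax _ _]]] := Bball A BA.
    by exists x => //; exact/esym/(single A x BA nB'A Ax).
  apply: countable_setU_card_le => //.
  by apply: card_le_trans (separable_card_le Hsep); exact: card_image_le.
(* The point [f (g s)] escapes [B'], so the member covering it is its own singleton. *)
- apply: (@injective_card_le _ _ _ (fun s => [set f (g s)])).
    move=> s s' /seteqP[/(_ _ erefl) /= E _]; apply: g_inj.
    by rewrite -(fP (g s)).2 E (fP (g s')).2.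
  move=> s; have [A BA Ax] : (\bigcup_(A in B) A) (f (g s)) by rewrite Bcov.
  by rewrite -(single A) // => B'A; exact: (fP (g s)).1 B'A Ax.
Qed.

Lemma open_covering_not_point_finite (R : realType) (H : completeNormedModType R)
    (B : set (set H)) :
  hilbert_space H -> infinite_dimensional H -> B `<=` open_balls H ->
  covering B -> ~ point_finite B.
Proof.
move=> /hilbert_inner_product[dot dotP] Hinf Bballs Bcov Bfin.
have [|u uP] := @orthonormal_sequence _ _ dot setT (fun=> 0).
  by move=> L; have [u [u1 uL]] := unit_orthogonal dotP L Hinf; exists u.
have uo i j : dot (u i) (u j) = (i == j)%:R.
  have [ij|ji|->] := ltngtP i j.
  - by rewrite (dotC dotP); have [_ _ _ ->] := uP j.
  - by have [_ _ _ ->] := uP i.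
  - by have [_ u1 _ _] := uP j; rewrite (dotxx dotP) u1 expr1n.
have [|x [xB _ xD]] := escape_rational_span dotP uo 0 _ Bfin.
  by move=> A /Bballs[c [r r0 ->]]; exists c, r; exact: ball_like_ball.
have [A BA Ax] : (\bigcup_(A in B) A) x by rewrite Bcov.
(* An open ball containing [x] also contains nearby points of the rational span, so it is among the
   members that [x] escapes. *)
apply: (xB A BA) => //; have [c [r r0 AE]] := Bballs A BA.
move: Ax; rewrite AE -ball_normE /= => xr.
have [|d Dd xd] := xD (r - `|c - x|); first by rewrite subr_gt0.
exists d; split=> //=; have := ler_normD (c - x) (x - d); rewrite subrKA.
by lra.
Qed.

(** Sending a real [t] to a basis index [g t] with countable fibers contradicts the smallness of
    [Gamma]. *)
Lemma orthonormal_basis_not_point_finite (R : realType)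
    (H : completeNormedModType R) (dot : H -> H -> R) (Gamma : choiceType)
    (delta : Gamma -> H) (B : set (set H)) :
  inner_product dot -> (forall i j, dot (delta i) (delta j) = (i == j)%:R) ->
  (forall x, (forall i, dot x (delta i) = 0) -> x = 0) ->
  infinite_set [set: Gamma] -> card_lt [set: Gamma] [set: set nat] ->
  B `<=` open_balls H `|` nondegenerate_closed_balls H ->
  covering B -> ~ point_finite B.
Proof.
move=> dotP delta_on delta_total /infinite_set_sequence[j j_inj] [_ Gamma_lt].
move=> Bballs Bcov Bfin.
pose u n := delta (j n).
have uo m n : dot (u m) (u n) = (m == n)%:R by rewrite delta_on (inj_eq j_inj).
have Bball_gt0 A : B A -> exists c r, 0 < r /\ ball_like A c r.
  by move=> /Bballs[] [c [r r0 ->]]; exists c, r; split=> //;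
    [exact: ball_like_ball | exact/ball_like_closed_ball/ltW].
have Bball A : B A -> exists c r, ball_like A c r.
  by move=> /Bball_gt0[c [r [_ Acr]]]; exists c, r.
pose D := rational_span u.
(* A t is tangent to the closure of D at x t; A t meets the rational span of D and
   of the basis vector at g t. *)
have /choice[f fP] t : exists p : H * set (H) * Gamma,
    let: (x, A, g) := p in
    [/\ dot x (u 0) = t, forall e, 0 < e -> exists2 d, D d & `|x - d| < e, B A,
      A x & ~ (A `&` D !=set0) /\
      A `&` [set q.1 + ratr q.2 *: delta g | q in D `*` [set: rat]] !=set0].
  have [x [xB xt xD]] := escape_rational_span dotP uo t Bball Bfin.
  have [A BA Ax] : (\bigcup_(A in B) A) x by rewrite Bcov.
  have AD : ~ (A `&` D !=set0) by move=> AD; exact: (xB A BA AD).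
  have [c [r [r_gt0 [r0 _ Ain Aout]]]] := Bball_gt0 A BA.
  (* [x] is a limit of points of [D]; were it interior to [A], then [A] would meet [D]. *)
  have xr : `|x - c| = r.
    apply/eqP; rewrite eq_le Aout// leNgt; apply/negP => xr; apply: AD.
    have [|d Dd xd] := xD (r - `|x - c|); first by rewrite subr_gt0.
    exists d; split=> //; apply: Ain; have := ler_normD (d - x) (x - c).
    by rewrite subrKA (distrC d x); lra.
  have [g xcg] : exists g, dot (x - c) (delta g) != 0.
    apply: contrapT => ng; have xc0 : x - c = 0.
      by apply: delta_total => g; apply/eqP/negPn/negP => xcg; apply: ng; exists g.
    by move: r_gt0; rewrite -xr xc0 normr0 ltxx.
  exists (x, A, g); split=> //; split=> //.
  (* This [h] minimizes the distance to [c] along [delta g], lowering its square by [h ^+ 2]. Half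
     of the slack then pays for [d] near [x], half for a rational near [h]. *)
  pose h := - dot (x - c) (delta g).
  have yr : `|x + h *: delta g - c| < r.
    rewrite -(@ltr_pXn2r _ 2)// ?nnegrE// addrAC (sqr_normD dotP) xr.
    rewrite (dotZr dotP) sqr_normM -(dotxx dotP) delta_on eqxx mulr1 /h.
    by have : 0 < dot (x - c) (delta g) ^+ 2; [rewrite exprn_even_gt0 | lra].
  have e0 : 0 < (r - `|x + h *: delta g - c|) / 2 by rewrite divr_gt0 ?subr_gt0.
  have [d Dd xd] := xD _ e0.
  have [q] : exists q, ratr q \in `]h, h + (r - `|x + h *: delta g - c|) / 2[.
    by apply: rat_in_itvoo; rewrite ltrDl.
  rewrite in_itv /= => /andP[hq qe].
  exists (d + ratr q *: delta g); split; last by exists (d, q).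
  apply: Ain; set y := x + h *: _ in e0 qe xd yr *.
  have delta1 : `|delta g| = 1.
    have : `|delta g| ^+ 2 = 1.
      by rewrite -(dotxx dotP) delta_on eqxx.
    move/eqP; rewrite sqrf_eq1 => /orP[/eqP//|/eqP ng].
    by have := normr_ge0 (delta g); rewrite ng; lra.
  have := ler_normD (d + ratr q *: delta g - y) (y - c); rewrite subrKA.
  have := ler_normD (d - x) ((ratr q - h) *: delta g).
  rewrite normrZ delta1 mulr1 (gtr0_norm (_ : 0 < ratr q - h)) ?subr_gt0//.
  rewrite (distrC d x) scalerBl addrACA -opprD -/y.
  by lra.
pose x t := (f t).1.1; pose A t := (f t).1.2; pose g t := (f t).2.
have {}fP t : [/\ dot (x t) (u 0) = t,
    forall e, 0 < e -> exists2 d, D d & `|x t - d| < e, B (A t),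
    A t (x t) & ~ (A t `&` D !=set0) /\
    A t `&` [set q.1 + ratr q.2 *: delta (g t) | q in D `*` [set: rat]] !=set0].
  by rewrite /x /A /g; have := fP t; case: (f t) => [[]].
(* Strict convexity: a ball tangent to the closure of D at two points would contain
   points of D near their midpoint. *)
have A_inj : injective A.
  move=> t t' Att'; have [xt xD BA Ax [AD _]] := fP t.
  have [xt' xD' _ Ax' _] := fP t'; rewrite -Att' in Ax'.
  apply: contrapT => tt'; have xx' : x t - x t' != 0.
    by rewrite subr_eq0; apply/eqP => E; apply: tt'; rewrite -xt -xt' E.
  have [c [r [r0 _ Ain Aout]]] := Bball _ BA.
  pose m := 2^-1 *: (x t + x t').
  have mr : `|m - c| < r.
    rewrite -(@ltr_pXn2r _ 2)// ?nnegrE//.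
    have p0 : 0 < `|x t - x t'| ^+ 2 by rewrite exprn_gt0 ?normr_gt0.
    have sq (z : H) : `|z| <= r -> `|z| ^+ 2 <= r ^+ 2.
      by move=> zr; rewrite ler_pXn2r ?nnegrE.
    have := sq _ (Aout _ Ax); have := sq _ (Aout _ Ax').
    have -> : m - c = 2^-1 *: ((x t - c) + (x t' - c)).
      rewrite /m addrACA -opprD scalerBr; congr (_ - _).
      by rewrite -[c + c]/(c *+ 2) -(scaler_nat 2 c) scalerA mulVf ?scale1r.
    have : `|x t - x t'| ^+ 2 = `|(x t - c) - (x t' - c)| ^+ 2.
      by rewrite opprB addrA subrK.
    rewrite sqr_normM (sqr_normD dotP _ (x t' - c)) (sqr_normB dotP (x t - c)).
    by lra.
  apply: AD.
  have e0 : 0 < r - `|m - c| by rewrite subr_gt0.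
  have [[d Dd dx] [d' Dd' dx']] := (xD _ e0, xD' _ e0).
  exists (2^-1 *: (d + d')); split; last exact: rational_span_midpoint.
  apply: Ain; have := ler_normD (2^-1 *: (d + d') - m) (m - c); rewrite subrKA.
  rewrite {1}/m -scalerBr normrZ opprD addrACA.
  have := ler_normD (d - x t) (d' - x t').
  rewrite (distrC d (x t)) (distrC d' (x t')) gtr0_norm ?invr_gt0//.
  by lra.
have [nat_real nat_real_inj] := set_nat_injects_in_reals R.
(* All [A t] with [g t = gamma] meet one countable set, so they are countably many; injectivity of
   [A] makes the fiber countable. *)
apply: Gamma_lt; apply: (@countable_fibers_card_le _ (g \o nat_real)) => gamma.
pose Dgamma := [set q.1 + ratr q.2 *: delta gamma | q in D `*` [set: rat]].
have Dgammac : countable Dgamma.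
  apply: sub_countable (card_image_le _ _) _; apply: countableX => //.
  exact: countable_rational_span.
apply: sub_countable (countable_meeting Bfin Dgammac).
rewrite -(card_le_eql (inj_card_eq (f := A \o nat_real) _)); last first.
  by move=> s s' _ _ /= /A_inj/nat_real_inj.
apply: subset_card_le => _ [s /= gs <-].
by have [_ _ BA _ [_ +]] := fP (nat_real s); rewrite gs.
Qed.

Theorem theorem2p7 (R : realType) :
  [/\ (forall (H : completeNormedModType R) (B : set (set H)),
         hilbert_space H -> separable H -> infinite_dimensional H ->
         B `<=` open_balls H `|` closed_balls H ->
         covering B -> point_finite B ->
         B #= [set: set nat]),
      (forall Gamma : choiceType,
         infinite_set [set: Gamma] ->
         card_lt [set: Gamma] [set: set nat] ->
         ~ exists B : set (set (l2 R Gamma)),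
             [/\ B `<=` open_balls (l2 R Gamma)
                        `|` nondegenerate_closed_balls (l2 R Gamma),
                 covering B & point_finite B])
    & (forall (H : completeNormedModType R) (B : set (set H)),
         hilbert_space H -> infinite_dimensional H ->
         B `<=` open_balls H ->
         covering B -> ~ point_finite B)].
Proof.
split=> [H B|Gamma Ginf Glt [B [Bballs Bcov Bfin]]|H B].
- exact: point_finite_covering_card.
- have [dot dotP] := hilbert_inner_product (l2_hilbert R Gamma).
  apply: (orthonormal_basis_not_point_finite (delta := @l2_delta R Gamma)
    dotP _ _ Ginf Glt Bballs Bcov Bfin) => [i j|x x0].
    by rewrite (dot_delta _ _ dotP) /= /delta_fun eq_sym.
  by apply: l2_ext => i; rewrite -(dot_delta x i dotP) x0.
- exact: open_covering_not_point_finite.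
Qed.
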